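(* (1) $F(n,3,0)=|\mathcal V(n)|$ for $n=3,4,5$ (these values are $2,8,14$ respectively). (2) $F(6,3,0)=21$. (3) $F(n,3,0)=\binom{n}{3}$ for all $n\ge 7$.
   Context: $F(n,k,l)$ is the maximum size of a family $\mathcal V$ of vectors in $\{0,\pm1\}^n$, each with exactly $k$ nonzero coordinates, such that $\langle\mathbf v,\mathbf w\rangle\ge l$ for all $\mathbf v,\mathbf w\in\mathcal V$ (standard scalar product). For $a<b<c$ in $[n]$, $\mathbf u(a,b,c)$ is the vector with entries $1$ at positions $a,b,c$ and $0$ elsewhere, and $\mathbf v(a,b,c)$ is the vector with entries $1$ at $a,b$, $-1$ at $c$, and $0$ elsewhere. $\mathcal V(n)=\{\mathbf u(a,b,c),\mathbf v(a,b,c): a<b<c \text{ in }[n],\ |\{a,b,c\}\cap\{1,2,3\}|\ge 2\}$. *)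

(* Defs.v *)
From HB Require Import structures.
From mathcomp Require Import all_boot all_order all_algebra.

Set Implicit Arguments.
Unset Strict Implicit.
Unset Printing Implicit Defensive.

Import Order.TTheory GRing.Theory Num.Theory.
Local Open Scope ring_scope.

(* The set {0, 1, -1} of integers, as a finite subtype of int. *)
Definition trits : seq int := [:: 0; 1; -1].
Definition trit : Type := seq_sub trits.
HB.instance Definition _ := Finite.on trit.
Coercion int_of_trit (x : trit) : int := ssval x.

Definition trit0 : trit := @SeqSub _ trits 0 isT.
Definition trit1 : trit := @SeqSub _ trits 1 isT.
Definition tritN1 : trit := @SeqSub _ trits (-1) isT.

Definition scalar_product (n : nat) (v w : 'rV[trit]_n) : int :=
  \sum_(i < n) (v 0 i : int) * (w 0 i : int).

Definition num_nonzero (n : nat) (v : 'rV[trit]_n) : nat :=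
  #|[set i : 'I_n | (v 0 i : int) != 0]|.

(* The quantification over pairs includes v = w. *)
Definition admissible (n k : nat) (l : int) (V : {set 'rV[trit]_n}) : bool :=
  [forall v in V, num_nonzero v == k] &&
  [forall v in V, forall w in V, l <= scalar_product v w].

(* The empty family is admissible, so this is a genuine maximum. *)
Definition F (n k : nat) (l : int) : nat :=
  \max_(V : {set 'rV[trit]_n} | admissible k l V) #|V|.

Definition uvec (n : nat) (a b c : 'I_n) : 'rV[trit]_n :=
  \row_i (if i \in [set a; b; c] then trit1 else trit0).

Definition vvec (n : nat) (a b c : 'I_n) : 'rV[trit]_n :=
  \row_i (if i \in [set a; b] then trit1 else if i == c then tritN1 else trit0).

(* Positions 1, ..., n are the elements 0, ..., n-1 of 'I_n, so that {1, 2, 3}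
   becomes the set of i with i < 3. *)
Definition Vfam (n : nat) : {set 'rV[trit]_n} :=
  [set x | [exists a : 'I_n, exists b : 'I_n, exists c : 'I_n,
     [&& (a < b < c)%N,
         (2 <= #|[set a; b; c] :&: [set i : 'I_n | (i < 3)%N]|)%N
       & x \in [set uvec a b c; vvec a b c]]]].

(* Main.v *)
From mathcomp Require Import all_boot all_order all_algebra zify.
Require Import Defs.

Set Implicit Arguments.
Unset Strict Implicit.
Unset Printing Implicit Defensive.

Import Order.TTheory GRing.Theory Num.Theory.

(** At most two vectors share a support B, and if two do, they differ in a
    single coordinate c of B, the free one; then no support meets B exactly in
    {c}.  The upper bounds use nothing else.  For a set S of points, let p and d
    count the supports and the doubled supports inside S.  For a point c of S
    let P be the graph of pairs completing c to a support, and D its subgraph of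
    pairs completing c to a doubled support with free point c: every edge of D
    meets every edge of P, so P is small once D has one, two or three edges.
    Summing over c (|P| sums to 3p and |D| to d) and using d <= p bounds p + d:
    - |S| = 5: |D| + |P| <= 6 at each point, so d + 3p <= 30 and p + d <= 14;
    - |S| = 6: if all |D| <= 2 then 5|D| + 2|P| <= 20, so 5d + 6p <= 120 and
      p + d <= 21; otherwise |P| <= 3 or P is a star at some c, which is deleted;
    - |S| = 7: if all |D| <= 3 then 3|D| + |P| <= 15, so 3(p + d) <= 105;
      otherwise |P| <= 5 at some c, which is deleted;
    - |S| > 7: averaging over the deletion of a point. *)

(** * Graphs [D] inside [P] on [X] with every edge of [D] meeting every edge of [P] *)

Section IntersectingPairs.
Variables (T : finType) (X : {set T}) (D P : {set {set T}}).
Hypothesis pairP : forall e, e \in P -> e \subset X /\ #|e| = 2.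
Hypothesis subDP : D \subset P.
Hypothesis meetDP : forall e p, e \in D -> p \in P -> e :&: p != set0.

Let star a := [set [set a; z] | z in X :\ a].

Let card_star a : a \in X -> #|star a| <= #|X|.-1.
Proof. by move=> aX; rewrite (cardsD1 a X) aX leq_imset_card. Qed.

Let mem_star a p : p \in P -> a \in p -> p \in star a.
Proof.
move=> /pairP[pX /eqP/cards2P[x [y [xy defp]]]].
have := pX; rewrite defp subUset !sub1set => /andP[xX yX].
rewrite !inE => /orP[] /eqP ->; apply/imsetP.
  by exists y; rewrite // !inE eq_sym xy.
by exists x; rewrite 1?setUC // !inE xy.
Qed.

Lemma links_meet e p : e \in D -> p \in P -> exists2 z, z \in e & z \in p.
Proof. by move=> eD /(meetDP eD)/set0Pn[z /setIP[]]; exists z. Qed.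

(** Every edge of [P] meets a fixed edge ab of [D]: at most [#|X| - 1] of them contain a, and at
    most [#|X| - 2] contain b but not a. *)
Lemma card_links_ge1 : 0 < #|D| -> #|P| <= 2 * #|X| - 3.
Proof.
case/card_gt0P=> e eD; have eP := subsetP subDP e eD.
have [eX /eqP/cards2P[a [b [ab defe]]]] := pairP eP.
have := eX; rewrite defe subUset !sub1set => /andP[aX bX].
have sub : P \subset star a :|: [set [set b; z] | z in X :\ b :\ a].
  apply/subsetP=> p pP; rewrite inE.
  have [z] := links_meet eD pP; rewrite defe !inE => /orP[]/eqP -> zp.
    by rewrite mem_star.
  have [ap|ap] := boolP (a \in p); first by rewrite mem_star.
  have /imsetP[y yX defp] := mem_star pP zp.
  apply/orP; right; apply/imsetP; exists y => //.
  rewrite inE yX andbT; apply: contra ap => /set1P ya.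
  by rewrite defp ya !inE eqxx orbT.
have cb : #|[set [set b; z] | z in X :\ b :\ a]| <= #|X|.-2.
  apply: leq_trans (leq_imset_card _ _) _.
  by rewrite (cardsD1 b X) (cardsD1 a (X :\ b)) bX !inE ab aX.
have X2 : 1 < #|X| by rewrite (cardsD1 b X) (cardsD1 a (X :\ b)) bX !inE ab aX.
apply: leq_trans (leq_trans (subset_leq_card sub) (leq_card_setU _ _).1) _.
by apply: leq_trans (leq_add (card_star aX) cb) _; move: #|X| X2 => N; lia.
Qed.

Lemma pair_joint e1 e2 : e1 \in D -> e2 \in D -> e1 != e2 ->
  exists a b c, [/\ a != b, a != c, b != c, e1 = [set a; b] & e2 = [set a; c]].
Proof.
move=> e1D e2D ne.
have e1P := subsetP subDP _ e1D; have e2P := subsetP subDP _ e2D.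
have [a ae1 ae2] := links_meet e1D e2P.
have /imsetP[b] := mem_star e1P ae1; rewrite !inE => /andP[ba _] d1.
have /imsetP[c] := mem_star e2P ae2; rewrite !inE => /andP[ca _] d2.
exists a, b, c; split; rewrite // 1?eq_sym //.
by apply: contra ne => /eqP cb; rewrite d1 d2 cb.
Qed.

Lemma mem_links2 a b c p :
  [set a; b] \in D -> [set a; c] \in D -> p \in P -> a \notin p ->
  (b \in p) && (c \in p).
Proof.
move=> abD acD pP ap.
have [z] := links_meet abD pP; rewrite !inE => /orP[]/eqP ->.
  by rewrite (negPf ap).
move=> ->.
by have [z'] := links_meet acD pP; rewrite !inE => /orP[]/eqP -> //; rewrite (negPf ap).
Qed.

Lemma pair_eq b c p : p \in P -> b != c -> b \in p -> c \in p -> p = [set b; c].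
Proof.
move=> /pairP[_ p2] bc bp cp; apply/eqP; rewrite eq_sym eqEcard p2 cards2 bc andbT.
by rewrite subUset !sub1set bp.
Qed.

(** Two edges of [D] share a point, say ab and ac. An edge of [P] that avoids a must contain b and
    c, so bc is the only edge outside the star of a. *)
Lemma card_links_ge2 : 1 < #|D| -> #|P| <= #|X|.
Proof.
case/card_gt1P=> e1 [e2 [e1D e2D ne]].
have [a [b [c [ab ac bc d1 d2]]]] := pair_joint e1D e2D ne.
have aX : a \in X.
  have [/subsetP sX _] := pairP (subsetP subDP _ e1D).
  by apply: sX; rewrite d1 !inE eqxx.
have sub : P \subset [set b; c] |: star a.
  apply/subsetP=> p pP; rewrite in_setU1.
  have [ap|ap] := boolP (a \in p); first by rewrite mem_star ?orbT.
  rewrite d1 in e1D; rewrite d2 in e2D.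
  have /andP[bp cp] := mem_links2 e1D e2D pP ap.
  by rewrite (pair_eq pP bc bp cp) eqxx.
apply: leq_trans (subset_leq_card sub) _; rewrite cardsU1 (cardsD1 a X) aX.
by apply: leq_add (leq_b1 _) _; apply: leq_imset_card.
Qed.

(** Take a third edge of [D] besides ab and ac. If it contains a, it misses bc, so bc is not in [P]
    and [P] is a star at a. Otherwise it is bc, and [P] lies in the triangle abc. *)
Lemma card_links_ge3 : 2 < #|D| ->
  #|P| <= 3 \/ exists2 a, a \in X & forall p, p \in P -> a \in p.
Proof.
case/card_gt2P=> e1 [e2 [e3 [[e1D e2D e3D] [n12 n23 n31]]]].
have [a [b [c [ab ac bc d1 d2]]]] := pair_joint e1D e2D n12.
have aX : a \in X.
  have [/subsetP sX _] := pairP (subsetP subDP _ e1D).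
  by apply: sX; rewrite d1 !inE eqxx.
have e3P := subsetP subDP _ e3D.
have abD := e1D; have acD := e2D; rewrite d1 in abD; rewrite d2 in acD.
have [ae3|ae3] := boolP (a \in e3).
  right; exists a => // p pP; apply/negPn/negP=> ap.
  have /andP[bp cp] := mem_links2 abD acD pP ap.
  have defp := pair_eq pP bc bp cp.
  have [z ze3] := links_meet e3D pP; rewrite defp !inE => /orP[]/eqP zE; subst z.
    by case/eqP: n31; rewrite (pair_eq e3P ab).
  by case/eqP: n23; rewrite (pair_eq e3P ac).
left; have /andP[be3 ce3] := mem_links2 abD acD e3P ae3.
have d3 := pair_eq e3P bc be3 ce3.
have sub : P \subset [set e1; e2; e3].
  apply/subsetP=> p pP; rewrite !inE.
  have [ap|ap] := boolP (a \in p); last first.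
    have /andP[bp cp] := mem_links2 abD acD pP ap.
    by rewrite d3 (pair_eq pP bc bp cp) eqxx !orbT.
  have [z] := links_meet e3D pP; rewrite d3 !inE => /orP[]/eqP -> zp.
    by rewrite (pair_eq pP ab ap zp) d1 eqxx.
  by rewrite (pair_eq pP ac ap zp) d2 eqxx orbT.
apply: leq_trans (subset_leq_card sub) _.
by apply: leq_trans (leq_card_setU _ _).1 _; rewrite cards1 cards2 addn1; case: (_ != _).
Qed.

Lemma card_star_links a : a \in X -> (forall p, p \in P -> a \in p) -> #|P| <= #|X|.-1.
Proof.
move=> aX aP; apply: leq_trans (card_star aX); apply: subset_leq_card.
by apply/subsetP=> p pP; rewrite mem_star ?aP.
Qed.

End IntersectingPairs.

Lemma card_filter_sum (I : finType) (A : {set I}) (Q : pred I) :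
  #|[set i in A | Q i]| = \sum_(i in A) Q i.
Proof.
rewrite -sum1_card big_mkcond [RHS]big_mkcond; apply: eq_bigr => i _.
by rewrite inE; case: (i \in A); case: (Q i).
Qed.

(** * Multiplicities [mu] on triples, with a free point [f B] in each doubled triple *)

Section WeightedTriples.
Variables (T : finType) (mu : {set T} -> nat) (f : {set T} -> T).
Hypothesis mu_le2 : forall B, mu B <= 2.
Hypothesis free_in : forall B, mu B = 2 -> f B \in B.
Hypothesis free_meet : forall B B', mu B = 2 -> B :&: B' = [set f B] -> mu B' = 0.

Definition subsets_of_card k (S : {set T}) : {set {set T}} :=
  [set B : {set T} | B \subset S & #|B| == k].

Local Notation pairs := (subsets_of_card 2).
Local Notation triples := (subsets_of_card 3).

Definition weight S := \sum_(B in triples S) mu B.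
Definition present S := [set B in triples S | 0 < mu B].
Definition doubled S := [set B in triples S | mu B == 2].
(** This is the graph P at c, and [free_link] is its subgraph D. *)
Definition present_link S c := [set e in pairs (S :\ c) | 0 < mu (c |: e)].
Definition free_link S c :=
  [set e in pairs (S :\ c) | (mu (c |: e) == 2) && (f (c |: e) == c)].

Lemma in_subsets_of_card k S B :
  (B \in subsets_of_card k S) = (B \subset S) && (#|B| == k).
Proof. by rewrite inE. Qed.

Lemma weightE (S : {set T}) : weight S = #|present S| + #|doubled S|.
Proof.
rewrite /present /doubled !card_filter_sum -big_split; apply: eq_bigr => B _ /=.
by case: (mu B) (mu_le2 B) => [|[|[]]].
Qed.

Lemma doubled_le_present (S : {set T}) : #|doubled S| <= #|present S|.
Proof.
apply/subset_leq_card/subsetP=> B; rewrite !inE => /andP[-> /eqP->] //.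
Qed.

(** Adding c and removing c are inverse bijections between pairs avoiding c and triples through
    c. *)
Lemma sum_link (S : {set T}) c (G : {set T} -> nat) : c \in S ->
  \sum_(e in pairs (S :\ c)) G (c |: e) = \sum_(B in triples S | c \in B) G B.
Proof.
move=> cS; rewrite [RHS](reindex_onto (fun e => c |: e) (fun B => B :\ c)) /=;
  last by move=> B /andP[_]; apply: setD1K.
apply: eq_bigl => e; rewrite !in_subsets_of_card in_setU1 eqxx andbT cardsU1.
rewrite subUset sub1set cS /= subsetD1.
have [ce|ce] := boolP (c \in e); last by rewrite setU1K // eqxx !andbT.
rewrite !andbF; apply/esym/negbTE; rewrite negb_and; apply/orP; right.
by apply/eqP=> E; move: ce; rewrite -E !inE eqxx.
Qed.

(** Double counting of incidences. [G] also depends on the point, so that a doubled triple can be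
    counted at its free point only. *)
Lemma sum_links (S : {set T}) (G : T -> {set T} -> nat) :
  \sum_(c in S) \sum_(e in pairs (S :\ c)) G c (c |: e) =
  \sum_(B in triples S) \sum_(c in B) G c B.
Proof.
under eq_bigr => c cS do rewrite (sum_link (G c) cS).
rewrite (exchange_big_dep (mem (triples S))) /=; last by move=> c B _ /andP[].
apply: eq_bigr => B BS; apply: eq_bigl => c; rewrite BS /=.
move: BS; rewrite in_subsets_of_card => /andP[/subsetP BS _].
by case cB: (c \in B); rewrite ?andbF ?andbT // BS.
Qed.

Lemma sum_present_link (S : {set T}) :
  \sum_(c in S) #|present_link S c| = 3 * #|present S|.
Proof.
under eq_bigr => c cS do rewrite /present_link card_filter_sum.
rewrite (sum_links S (fun _ B => 0 < mu B)) /present card_filter_sum big_distrr /=.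
apply: eq_bigr => B; rewrite in_subsets_of_card => /andP[_ /eqP B3].
by rewrite sum_nat_const B3.
Qed.

Lemma sum_free_link (S : {set T}) : \sum_(c in S) #|free_link S c| = #|doubled S|.
Proof.
under eq_bigr => c cS do rewrite /free_link card_filter_sum.
rewrite (sum_links S (fun c B => (mu B == 2) && (f B == c))) /doubled card_filter_sum.
apply: eq_bigr => B _; have [/eqP B2|_] := boolP (mu B == 2); last by rewrite big1.
rewrite (bigD1 (f B)) ?free_in //= eqxx big1 // => c /andP[_].
by rewrite eq_sym => /negbTE->.
Qed.

Lemma weight_del (S : {set T}) c : c \in S ->
  weight S = \sum_(e in pairs (S :\ c)) mu (c |: e) + weight (S :\ c).
Proof.
move=> cS; rewrite (sum_link mu cS) /weight.
rewrite (bigID (fun B : {set T} => c \in B)) /=; congr (_ + _).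
by apply: eq_bigl => B; rewrite !in_subsets_of_card subsetD1 andbAC.
Qed.

Lemma sum_link_le (S : {set T}) c :
  \sum_(e in pairs (S :\ c)) mu (c |: e) <= 2 * #|present_link S c|.
Proof.
rewrite /present_link card_filter_sum big_distrr; apply: leq_sum => e _ /=.
by have := mu_le2 (c |: e); case: (mu _).
Qed.

(** A triple survives the deletion of each of the [#|S| - 3] points outside it. *)
Lemma sum_weight_del (S : {set T}) :
  \sum_(c in S) weight (S :\ c) = (#|S| - 3) * weight S.
Proof.
rewrite /weight (exchange_big_dep (mem (triples S))) /=; last first.
  by move=> c B _; rewrite !in_subsets_of_card subsetD1 => /andP[/andP[->]].
rewrite big_distrr; apply: eq_bigr => B; rewrite in_subsets_of_card => /andP[BS B3] /=.
rewrite -(eqP B3) -(setIidPr BS) -cardsD (setIidPr BS) -sum_nat_const.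
apply: eq_bigl => c; rewrite in_subsets_of_card subsetD1 BS eqxx inE andbT /=.
by rewrite andbC.
Qed.

(** * The two graphs at a single point *)

Section Links.
Variables (S : {set T}) (c : T).
Hypothesis cS : c \in S.

Lemma card_link_points : #|S :\ c| = #|S|.-1.
Proof. by rewrite (cardsD1 c S) cS. Qed.

Lemma present_linkP e : e \in present_link S c -> e \subset S :\ c /\ #|e| = 2.
Proof. by rewrite !inE => /andP[/andP[-> /eqP->]]. Qed.

Lemma free_link_sub : free_link S c \subset present_link S c.
Proof. by apply/subsetP=> e; rewrite !inE => /andP[-> /andP[/eqP->]]. Qed.

(** If e and p were disjoint, [c |: e] and [c |: p] would meet exactly in c, the free point of the
    doubled [c |: e], and [c |: p] could not be present. *)
Lemma links_cross e p :
  e \in free_link S c -> p \in present_link S c -> e :&: p != set0.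
Proof.
rewrite !inE => /andP[_ /andP[/eqP e2 /eqP fe]] /andP[_]; rewrite lt0n.
apply: contra => /eqP ep; apply/eqP/(free_meet e2).
by rewrite fe -setUIr ep setU0.
Qed.

Lemma card_present_link : #|present_link S c| <= 'C(#|S|.-1, 2).
Proof.
rewrite -card_link_points -cards_draws; apply/subset_leq_card/subsetP=> e.
by rewrite !inE => /andP[].
Qed.

Lemma link_bound1 : 0 < #|free_link S c| -> #|present_link S c| <= 2 * #|S|.-1 - 3.
Proof.
rewrite -card_link_points; exact: card_links_ge1 present_linkP free_link_sub links_cross.
Qed.

Lemma link_bound2 : 1 < #|free_link S c| -> #|present_link S c| <= #|S|.-1.
Proof.
rewrite -card_link_points; exact: card_links_ge2 present_linkP free_link_sub links_cross.
Qed.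

Lemma link_bound3 : 2 < #|free_link S c| -> #|present_link S c| <= 3 \/
  exists2 x, x \in S :\ c & forall p, p \in present_link S c -> x \in p.
Proof. exact: card_links_ge3 present_linkP free_link_sub links_cross. Qed.

Lemma link_star x : x \in S :\ c ->
  (forall p, p \in present_link S c -> x \in p) -> #|present_link S c| <= #|S|.-2.
Proof.
move=> xS xp; have := card_star_links present_linkP xS xp; by rewrite card_link_points.
Qed.

Lemma free_le_present : #|free_link S c| <= #|present_link S c|.
Proof. exact: subset_leq_card free_link_sub. Qed.

Lemma weight_del_le : weight S <= 2 * #|present_link S c| + weight (S :\ c).
Proof. by rewrite (weight_del cS) leq_add2r sum_link_le. Qed.

End Links.

(** From five points on, the bound 3 of the triangle case is absorbed by that of the star case. *)
Lemma link_bound3_card (S : {set T}) c : c \in S -> 4 < #|S| -> 2 < #|free_link S c| ->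
  #|present_link S c| <= #|S|.-2.
Proof.
move=> cS S4 /link_bound3[P3|[x xS xp]]; last exact: (link_star cS xS xp).
by apply: leq_trans P3 _; lia.
Qed.

(** * Weight bounds on five, six, seven and more points *)

Lemma weight5 (S : {set T}) : #|S| = 5 -> weight S <= 14.
Proof.
move=> S5; rewrite weightE.
have : \sum_(c in S) (#|free_link S c| + #|present_link S c|) <= \sum_(c in S) 6.
  apply: leq_sum => c cS.
  (* For d = 0, 1, 2 and d >= 3 the bounds on p are 6, 5, 4 and 3; in the last case d <= p. *)
  have := card_present_link cS; have := link_bound1 cS; have := link_bound2 cS.
  have := link_bound3_card cS; have := free_le_present S c.
  rewrite S5 (_ : 'C(4, 2) = 6) //.
  move: #|free_link S c| #|present_link S c| => d p; lia.
rewrite big_split sum_free_link sum_present_link sum_nat_const S5 /=.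
(* From d + 3p <= 30 and d <= p, p + d <= 15; equality would force p = d, which parity forbids. *)
have := doubled_le_present S; move: #|doubled S| #|present S| => d p; lia.
Qed.

(* Here c has a full star as link: {c, x, y} is a support for every other y. *)
Lemma weight6_star (S : {set T}) c x : #|S| = 6 -> c \in S -> x \in S :\ c ->
  2 < #|free_link S c| -> (forall p, p \in present_link S c -> x \in p) ->
  #|present_link S c| = 4 -> weight (S :\ c) <= 13.
Proof.
move=> S6 cS xS D3 xP P4; set Y := S :\ c :\ x.
have xc : x != c by move: xS; rewrite !inE => /andP[].
have Y4 : #|Y| = 4.
  by have := cardsD1 x (S :\ c); rewrite xS card_link_points // S6 => -[].
have cY : c \notin Y by rewrite !inE eqxx andbF.
have xY : x \notin Y by rewrite !inE eqxx.
have full y : y \in Y -> 0 < mu (c |: [set x; y]).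
  move=> yY.
  have starE : present_link S c = [set [set x; z] | z in Y].
    apply/eqP; rewrite eqEcard P4; apply/andP; split.
      apply/subsetP=> p pP; apply/imsetP.
      have [pS /eqP/cards2P[a [b [ab defp]]]] := present_linkP pP.
      move: (xP _ pP) pS; rewrite defp subUset !sub1set !inE.
      case/orP=> /eqP xE; subst x => /andP[aS bS]; [exists b | exists a] => //.
        by rewrite !inE eq_sym ab.
        by rewrite !inE ab.
      by rewrite setUC.
    by rewrite (leq_trans (leq_imset_card _ _)) ?Y4.
  have : [set x; y] \in present_link S c by rewrite starE; apply/imsetP; exists y.
  by rewrite inE => /andP[].
rewrite (weight_del xS) -/Y.
(* A doubled triple inside Y, free at y, would meet {c, x, y} only in y. *)
have muY B : B \in triples Y -> mu B <= 1.
  rewrite in_subsets_of_card => /andP[BY _].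
  rewrite leqNgt; apply/negP=> B2.
  have {}B2 : mu B = 2 by have := mu_le2 B; lia.
  have fB := free_in B2; have := full _ (subsetP BY _ fB).
  rewrite (free_meet B2) //; apply/setP=> z; rewrite !inE.
  have [->|zf] := eqVneq z (f B); first by rewrite fB !orbT.
  rewrite orbF; apply/negbTE/negP=> /andP[/(subsetP BY) zY /orP[]/eqP zE]; subst z.
    by rewrite zY in cY.
  by rewrite zY in xY.
(* A triple of the four-point set [Y] is encoded by the point it omits. *)
pose Q := [set i in Y | 0 < mu (Y :\ i)].
have WY : weight Y <= #|Q|.
  apply: (@leq_trans #|present Y|).
    rewrite /weight /present card_filter_sum; apply: leq_sum => B /muY.
    by case: (mu B) => [|[]].
  apply: leq_trans (leq_imset_card (fun i => Y :\ i) _).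
  apply/subset_leq_card/subsetP=> B; rewrite inE in_subsets_of_card.
  move=> /andP[/andP[BY /eqP B3] B0].
  have /cards1P[i Di] : #|Y :\: B| == 1 by rewrite cardsD (setIidPr BY) Y4 B3.
  have BE : B = Y :\ i by rewrite -Di setDDr setDv set0U (setIidPr BY).
  apply/imsetP; exists i => //; rewrite inE -BE B0 andbT.
  by have := set11 i; rewrite -Di inE => /andP[].
(* A doubled {x, i, j} is free at i or j, since {x, c, k} is present for the
   remaining k; if it is free at i then it excludes Y :\ j. *)
have mux e : e \in pairs Q -> mu (x |: e) <= 1.
  rewrite in_subsets_of_card => /andP[eQ /cards2P[i [j [ij defe]]]].
  rewrite leqNgt; apply/negP=> B2.
  have {}B2 : mu (x |: e) = 2 by have := mu_le2 (x |: e); lia.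
  have inQ k : k \in e -> k \in Y /\ 0 < mu (Y :\ k).
    by move/(subsetP eQ); rewrite inE => /andP[].
  have [iY iQ] : i \in Y /\ 0 < mu (Y :\ i) by apply: inQ; rewrite defe !inE eqxx.
  have [jY jQ] : j \in Y /\ 0 < mu (Y :\ j) by apply: inQ; rewrite defe !inE eqxx orbT.
  have xi : x != i by apply: contraNneq xY => ->.
  have xj : x != j by apply: contraNneq xY => ->.
  have ci : c != i by apply: contraNneq cY => ->.
  have cj : c != j by apply: contraNneq cY => ->.
  have : f (x |: e) \in x |: e by apply: free_in.
  rewrite {2}defe !inE => /or3P[]/eqP fE.
  - have /card_gt0P[k] : 0 < #|Y :\ i :\ j|.
      have := cardsD1 i Y; have := cardsD1 j (Y :\ i).
      rewrite iY in_setD1 jY eq_sym ij Y4 /= => E1 E2.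
      by move: E2; rewrite E1; case: #|_|.
    rewrite in_setD1 in_setD1 => /and3P[kj ki kY].
    have := full _ kY; rewrite (free_meet B2) // fE defe.
    apply/setP=> z; rewrite !inE; have [->|zx] := eqVneq z x; first by rewrite orbT.
    apply/negbTE/negP=> /= /andP[/orP[]/eqP-> /orP[]/eqP E].
    + by rewrite E eqxx in ci.
    + by rewrite E eqxx in ki.
    + by rewrite E eqxx in cj.
    + by rewrite E eqxx in kj.
  - move: jQ; rewrite (free_meet B2) // fE defe; apply/setP=> z.
    rewrite in_setI !in_setU !in_set1 in_setD1.
    have [->|zi] := eqVneq z i; first by rewrite ij iY orbT.
    have [->|zx] := eqVneq z x; first by rewrite (negPf xY) andbF.
    by case: eqVneq.
  - move: iQ; rewrite (free_meet B2) // fE defe; apply/setP=> z.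
    rewrite in_setI !in_setU !in_set1 in_setD1.
    have [->|zj] := eqVneq z j; first by rewrite (eq_sym j i) ij jY !orbT.
    have [->|zx] := eqVneq z x; first by rewrite (negPf xY) andbF.
    by case: eqVneq.
have QY : Q \subset Y by apply/subsetP=> i; rewrite inE => /andP[].
have sumx : \sum_(e in pairs Y) mu (x |: e) + #|pairs Q| <= 2 * #|pairs Y|.
  have -> : #|pairs Q| = \sum_(e in pairs Y) (e \in pairs Q).
    rewrite -card_filter_sum; apply: eq_card => e; rewrite !inE.
    by case eQ: (e \subset Q); rewrite ?andbF // (subset_trans eQ QY) /=; case: (_ == _).
  rewrite -big_split mulnC -sum_nat_const; apply: leq_sum => e _ /=.
  case eQ: (e \in pairs Q); last by rewrite addn0.
  by rewrite addn1 ltnS mux.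
have : #|Q| <= 4 by rewrite -Y4 subset_leq_card.
(* With q = [#|Q|], the total is at most 12 - q(q - 1)/2 + q, whose largest value is 13, reached at
   q = 1 and q = 2. *)
move: sumx; rewrite /subsets_of_card !cards_draws Y4 (_ : 'C(4, 2) = 6) // bin2.
case: #|Q| WY => [|[|[|[|[|q]]]]] //=; move: (weight Y) => w; rewrite /=; lia.
Qed.

Lemma weight6 (S : {set T}) : #|S| = 6 -> weight S <= 21.
Proof.
move=> S6.
have [c /andP[cS D3]|small] := pickP [pred c in S | 2 < #|free_link S c|].
- have Wc := weight_del_le cS.
  have W5 : weight (S :\ c) <= 14 by apply: weight5; rewrite card_link_points // S6.
  have P4 : #|present_link S c| <= 4.
    by have := link_bound3_card cS _ D3; rewrite S6; apply.
  (* With at most 3 edges the total is at most 6 + 14. A star of 4 edges would give only 8 + 14 =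
     22, hence the sharper bound 13 of [weight6_star]. *)
  have [P3|[x xS xP]] := link_bound3 D3; first by lia.
  have [/eqP PE|Pn] := boolP (#|present_link S c| == 4); last by lia.
  by have := weight6_star S6 cS xS D3 xP PE; lia.
rewrite weightE.
have : \sum_(c in S) (5 * #|free_link S c| + 2 * #|present_link S c|) <=
    \sum_(c in S) 20.
  apply: leq_sum => c cS.
  (* For d = 0, 1, 2 the bounds on p are 10, 7, 5; the coefficients 5 and 2 make d = 0 and d = 2
     both reach 20. *)
  have := card_present_link cS; have := link_bound1 cS; have := link_bound2 cS.
  have := small c; rewrite /= cS S6 (_ : 'C(5, 2) = 10) //.
  move: #|free_link S c| #|present_link S c| => d p; lia.
rewrite big_split -!big_distrr sum_free_link sum_present_link sum_nat_const S6 /=.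
(* Doubling 5d + 6p <= 120 and using d <= p gives 11(p + d) <= 240. *)
have := doubled_le_present S; move: #|doubled S| #|present S| => d p; lia.
Qed.

Lemma weight7 (S : {set T}) : #|S| = 7 -> weight S <= 35.
Proof.
move=> S7.
have [c /andP[cS D4]|small] := pickP [pred c in S | 3 < #|free_link S c|].
- have Wc := weight_del_le cS.
  have W6 : weight (S :\ c) <= 21 by apply: weight6; rewrite card_link_points // S7.
  have : #|present_link S c| <= 5.
    by have := link_bound3_card cS _ (ltnW D4); rewrite S7; apply.
  by lia.
rewrite weightE.
have : \sum_(c in S) (3 * #|free_link S c| + #|present_link S c|) <=
    \sum_(c in S) 15.
  apply: leq_sum => c cS.
  (* For d = 0, 1, 2, 3 the bounds on p are 15, 9, 6, 5. *)
  have := card_present_link cS; have := link_bound1 cS; have := link_bound2 cS.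
  have := link_bound3_card cS.
  have := small c; rewrite /= cS S7 (_ : 'C(6, 2) = 15) //.
  move: #|free_link S c| #|present_link S c| => d p; lia.
rewrite big_split -!big_distrr sum_free_link sum_present_link sum_nat_const S7 /=.
move: #|doubled S| #|present S| => d p; lia.
Qed.

Lemma weight_ge7 n (S : {set T}) : #|S| = n -> 7 <= n -> weight S <= 'C(n, 3).
Proof.
elim: n S => // n IHn S Sn; rewrite leq_eqVlt => /orP[/eqP n7|n7].
  by rewrite -n7 in Sn *; apply: weight7.
have : \sum_(c in S) weight (S :\ c) <= \sum_(c in S) 'C(n, 3).
  by apply: leq_sum => c cS; apply: IHn => //; rewrite card_link_points // Sn.
(* The binomial identity turns the right side into [(n.+1 - 3) * 'C(n.+1, 3)], and the common factor
   is positive. *)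
by rewrite sum_weight_del sum_nat_const Sn (mul_bin_down n.+1) leq_pmul2l //; lia.
Qed.

(** This crude bound is what settles n = 3 and n = 4. *)
Lemma weight_le_double (S : {set T}) k : #|S| = k -> weight S <= 2 * 'C(k, 3).
Proof.
move=> <-; rewrite -cards_draws mulnC -sum_nat_const; exact: leq_sum.
Qed.

End WeightedTriples.

(** * Supports of the vectors of an admissible family *)

Lemma tritP (x : trit) : [\/ (x : int) = 0%R, (x : int) = 1%R | (x : int) = (-1)%R].
Proof.
have := ssvalP x; rewrite !inE => /or3P[] /eqP E;
  [by apply: Or31 | by apply: Or32 | by apply: Or33].
Qed.

Lemma trit_neq_opp (x y : trit) : (x : int) != 0%R -> (y : int) != 0%R -> x != y ->
  (x : int) = (- (y : int))%R.
Proof.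
move=> x0 y0; have : (x != y) = ((x : int) != (y : int)) by [].
move=> -> ; move: x0 y0.
by case: (tritP x) => ->; case: (tritP y) => ->.
Qed.

Section Supports.
Local Open Scope ring_scope.
Variables (n : nat) (V : {set 'rV[trit]_n}).
Hypothesis adV : admissible 3 0 V.

Definition supp (v : 'rV[trit]_n) : {set 'I_n} := [set i | (v 0 i : int) != 0].
Definition mult (B : {set 'I_n}) : nat := #|[set v in V | supp v == B]|.
Definition diff (v w : 'rV[trit]_n) : {set 'I_n} := [set i | v 0 i != w 0 i].

Lemma in_supp v i : (i \in supp v) = ((v 0 i : int) != 0).
Proof. by rewrite inE. Qed.

Lemma adm_card v : v \in V -> #|supp v| = 3%N.
Proof. by case/andP: adV => /forall_inP H _ /H/eqP. Qed.

Lemma adm_ge0 v w : v \in V -> w \in V -> 0 <= scalar_product v w.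
Proof. by case/andP: adV => _ /forall_inP H vV wV; apply: (forall_inP (H v vV)). Qed.

Lemma scalar_productE v w :
  scalar_product v w = \sum_(i in supp v :&: supp w) (v 0 i : int) * (w 0 i : int).
Proof.
rewrite /scalar_product [RHS]big_mkcond; apply: eq_bigr => i _.
rewrite in_setI !in_supp; case: eqVneq => [->|_] /=; first by rewrite mul0r.
by case: eqVneq => [->|_] //=; rewrite mulr0.
Qed.

Lemma diff_sub v w : supp v = supp w -> diff v w \subset supp v.
Proof.
move=> E; apply/subsetP=> i; rewrite inE; apply: contraR => iv.
have := iv; rewrite {1}E !in_supp !negbK => /eqP w0.
move: iv; rewrite in_supp negbK => /eqP v0.
by apply/eqP/val_inj; exact: etrans v0 (esym w0).
Qed.

(** A common nonzero coordinate contributes 1 where the signs agree and -1 where they differ. *)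
Lemma scalar_product_diff v w : supp v = supp w ->
  scalar_product v w = #|supp v|%:R - #|diff v w|%:R * 2.
Proof.
move=> E; rewrite scalar_productE -E setIid.
have -> : diff v w = [set i in supp v | v 0 i != w 0 i].
  apply/setP=> i; rewrite [RHS]inE.
  case: (boolP (i \in diff v w)) => [iD|];
    last by rewrite inE => /negbTE->; rewrite andbF.
  by rewrite (subsetP (diff_sub E)) //; move: iD; rewrite inE => ->.
rewrite card_filter_sum -sum1_card !natr_sum mulr_suml -sumrB; apply: eq_bigr => i iv.
have v0 := iv; rewrite in_supp in v0; have w0 := iv; rewrite E in_supp in w0.
have [<-|/(trit_neq_opp v0 w0) ->] := eqVneq (v 0 i) (w 0 i).
  by case: (tritP (v 0 i)) v0 => ->.
by case: (tritP (w 0 i)) w0 => ->.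
Qed.

Lemma diff0_eq v w : diff v w = set0 -> v = w.
Proof.
move=> /setP D; apply/rowP=> i; apply/eqP; have := D i.
by rewrite in_set0 inE => /negbFE.
Qed.

(** The scalar product is 3 - 2d with d differing coordinates, so it is nonnegative only for d <=
    1. *)
Lemma same_supp_diff v w : v \in V -> w \in V -> supp v = supp w -> v != w ->
  exists2 c, c \in supp v & diff v w = [set c].
Proof.
move=> vV wV E vw; have := adm_ge0 vV wV.
rewrite (scalar_product_diff E) adm_card // !natz => D.
have /cards1P[c Dc] : #|diff v w| == 1%N.
  have : (0 < #|diff v w|)%N.
    by rewrite card_gt0; apply: contra vw => /eqP/diff0_eq->.
  move: D; move: #|diff v w| => d; lia.
by exists c => //; rewrite (subsetP (diff_sub E)) // Dc inE.
Qed.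

(** Among three signs the number of unequal pairs is even, whereas three distinct vectors on one
    support would show three unequal pairs over all coordinates. *)
Lemma mult_le2 B : (mult B <= 2)%N.
Proof.
rewrite leqNgt; apply/negP=> /card_gt2P[u [v [w []]]].
rewrite !inE => -[/andP[uV /eqP uB] /andP[vV /eqP vB] /andP[wV /eqP wB]] [uv vw wu].
have [c cB /setP Dc] := same_supp_diff uV vV (etrans uB (esym vB)) uv.
have [d dB /setP Dd] := same_supp_diff vV wV (etrans vB (esym wB)) vw.
have [e eB /setP De] := same_supp_diff wV uV (etrans wB (esym uB)) wu.
have tri i : i \in B -> ((i == c) (+) (i == d) (+) (i == e)) = false.
  move=> iB; move: (Dc i) (Dd i) (De i); rewrite !inE => <- <- <-.
  have /= := iB; rewrite -{1}uB in_supp => u0.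
  have /= := iB; rewrite -{1}vB in_supp => v0.
  have /= := iB; rewrite -{1}wB in_supp => w0.
  have E (x y : trit) : (x != y) = ((x : int) != (y : int)) by [].
  rewrite !E; case: (tritP (u 0 i)) u0 => ->; case: (tritP (v 0 i)) v0 => ->;
    by case: (tritP (w 0 i)) w0 => ->.
rewrite uB in cB; rewrite vB in dB; rewrite wB in eB.
(* By parity at c, d and e, of any two of the equalities c = d, c = e, d = e exactly one holds,
   which is impossible. *)
move: (tri c cB) (tri d dB) (tri e eB).
rewrite !eqxx (eq_sym d c) (eq_sym e c) (eq_sym e d).
by case: (c == d); case: (c == e); case: (d == e).
Qed.

(** The two vectors on B have opposite entries at c. A vector whose support meets B only in c would
    have opposite nonzero scalar products with them, one of them negative. *)
Lemma mult2_free B : mult B = 2%N -> exists c, (c \in B) /\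
  forall B', B :&: B' = [set c] -> mult B' = 0%N.
Proof.
move=> B2; have /card_gt1P[v [w []]] : (1 < mult B)%N by rewrite B2.
rewrite !inE => /andP[vV /eqP vB] /andP[wV /eqP wB] vw.
have E := etrans vB (esym wB).
have [c cv Dc] := same_supp_diff vV wV E vw.
exists c; split; first by rewrite -vB.
move=> B' BB'; apply/eqP; rewrite cards_eq0; apply/set0Pn=> -[z].
rewrite inE => /andP[zV /eqP zB].
have := adm_ge0 vV zV; have := adm_ge0 wV zV.
rewrite !scalar_productE vB wB zB BB' !big_set1.
have cz : c \in supp z by rewrite zB; have := set11 c; rewrite -BB' inE => /andP[].
have cw := cv; rewrite E in cw; rewrite !in_supp in cv cw cz.
have : c \in diff v w by rewrite Dc set11.
rewrite inE => /(trit_neq_opp cv cw) ->.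
by case: (tritP (w 0 c)) cw => ->; case: (tritP (z 0 c)) cz => ->.
Qed.

Lemma weight_mult : weight mult [set: 'I_n] = #|V|.
Proof.
rewrite /weight -[RHS]sum1_card.
rewrite (partition_big supp (mem (subsets_of_card 3 [set: 'I_n]))) /=.
  apply: eq_bigr => B _; rewrite /mult -sum1_card; apply: eq_bigl => v.
  by rewrite inE.
by move=> v vV; rewrite in_subsets_of_card subsetT adm_card.
Qed.

End Supports.

Lemma mult_free n (V : {set 'rV[trit]_n}) : 0 < n -> admissible 3 0%R V ->
  exists f : {set 'I_n} -> 'I_n, forall B, mult V B = 2 ->
    f B \in B /\ forall B', B :&: B' = [set f B] -> mult V B' = 0.
Proof.
move=> n0 adV; apply: (@fin_all_exists _ (fun=> 'I_n) (fun B c => mult V B = 2 ->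
  c \in B /\ forall B', B :&: B' = [set c] -> mult V B' = 0)) => B.
(* The choice function is total: off the doubled supports it takes a default point, which exists as
   n > 0. *)
have [/eqP B2|/eqP B2] := boolP (mult V B == 2); last by exists (Ordinal n0).
by have [c cP] := mult2_free adV B2; exists c.
Qed.

Lemma admissible_card_le n (V : {set 'rV[trit]_n}) : 0 < n -> admissible 3 0%R V ->
  [/\ #|V| <= 2 * 'C(n, 3), n = 5 -> #|V| <= 14, n = 6 -> #|V| <= 21
    & 7 <= n -> #|V| <= 'C(n, 3)].
Proof.
move=> n0 adV; have [f fP] := mult_free n0 adV.
have le2 := mult_le2 adV; have fin B B2 := (fP B B2).1.
have fmeet B B' B2 : B :&: B' = [set f B] -> mult V B' = 0 := (fP B B2).2 B'.
have cardT : #|[set: 'I_n]| = n by rewrite cardsT card_ord.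
rewrite -(weight_mult adV); split => [|n5|n6|n7].
- exact: weight_le_double.
- by apply: (weight5 le2 fin fmeet); rewrite cardT.
- by apply: (weight6 le2 fin fmeet); rewrite cardT.
- exact: (weight_ge7 le2 fin fmeet).
Qed.

(** * Families of vectors given by triples with a sign at the last point *)

Section SignedTriples.
Local Open Scope ring_scope.
Variable n : nat.
Implicit Types (a b c : 'I_n) (s : bool).

(** Triples need not be increasing, so the signed point can be placed last in any support, as in
    [triples6]. *)
Definition svec (t : 'I_n * 'I_n * 'I_n) s : 'rV[trit]_n :=
  if s then vvec t.1.1 t.1.2 t.2 else uvec t.1.1 t.1.2 t.2.

Definition distinct3 (t : 'I_n * 'I_n * 'I_n) :=
  [&& t.1.1 != t.1.2, t.1.1 != t.2 & t.1.2 != t.2].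

Definition set3 (t : 'I_n * 'I_n * 'I_n) : {set 'I_n} := [set t.1.1; t.1.2; t.2].

(** Indices are plain numbers, so that scalar products compute under case analysis on them. *)
Definition signed_delta (a b c : nat) s (i : nat) : int :=
  (i == a)%:Z + (i == b)%:Z + (if s then - (i == c)%:Z else (i == c)%:Z).

Lemma svecE t s i : distinct3 t ->
  (svec t s 0 i : int) = signed_delta t.1.1 t.1.2 t.2 s i.
Proof.
rewrite /signed_delta !val_eqE.
case: t => [[a b] c] /and3P[/= ab ac bc].
case: s; rewrite /svec /= mxE !inE.
all: have [->|ia] := eqVneq i a; first by rewrite (negPf ab) (negPf ac).
all: have [->|ib] := eqVneq i b; first by rewrite (negPf bc).
all: by case: eqVneq.
Qed.

Lemma supp_svec t s : distinct3 t -> supp (svec t s) = set3 t.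
Proof.
move=> d; apply/setP=> i; rewrite in_supp svecE // /signed_delta !val_eqE !inE.
case: t d => [[a b] c] /and3P[/= ab ac bc].
have [->|ia] := eqVneq i a; first by rewrite (negPf ab) (negPf ac); case: s.
have [->|ib] := eqVneq i b; first by rewrite (negPf bc); case: s.
by case: (eqVneq i c); case: s.
Qed.

Lemma card_set3 t : distinct3 t -> #|set3 t| = 3%N.
Proof.
case: t => [[a b] c] /and3P[/= ab ac bc].
by rewrite /set3 setUC cardsU1 cards2 ab !inE negb_or eq_sym ac eq_sym bc.
Qed.

Lemma sum_delta a (w : 'I_n -> int) : \sum_i (i == a)%:Z * w i = w a.
Proof.
rewrite (bigD1 a) //= eqxx mul1r big1 ?addr0 // => i /negbTE->.
by rewrite mul0r.
Qed.

Lemma scalar_svec t s (w : 'rV[trit]_n) : distinct3 t -> scalar_product (svec t s) w =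
  (w 0 t.1.1 : int) + (w 0 t.1.2 : int) +
  (if s then - (w 0 t.2 : int) else (w 0 t.2 : int)).
Proof.
move=> d; rewrite /scalar_product.
under eq_bigr => i _ do rewrite (svecE s i d) /signed_delta !val_eqE !mulrDl.
rewrite !big_split /= !(sum_delta _ (fun i => w 0 i : int)); congr (_ + _).
case: s; last exact: (sum_delta _ (fun i => w 0 i : int)).
under eq_bigr => i _ do rewrite mulNr.
by rewrite sumrN (sum_delta _ (fun i => w 0 i : int)).
Qed.

Lemma scalar_svec2 t t' s s' : distinct3 t -> distinct3 t' ->
  scalar_product (svec t s) (svec t' s') =
  let d := signed_delta t'.1.1 t'.1.2 t'.2 s' in
  d t.1.1 + d t.1.2 + (if s then - d t.2 else d t.2).
Proof. by move=> d d'; rewrite scalar_svec // !svecE. Qed.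

Definition signed_family (A : {set 'I_n * 'I_n * 'I_n}) : {set 'rV[trit]_n} :=
  [set svec u.1 u.2 | u in setX A [set: bool]].

Lemma signed_familyP (A : {set 'I_n * 'I_n * 'I_n}) x :
  reflect (exists t s, t \in A /\ x = svec t s) (x \in signed_family A).
Proof.
apply: (iffP imsetP) => [[[t s] /setXP[tA _] ->]|[t [s [tA ->]]]].
  by exists t, s.
by exists (t, s) => //; rewrite inE /= tA inE.
Qed.

(** The support recovers the triple, and the entry at its last point recovers the sign. *)
Lemma card_signed_family (A : {set 'I_n * 'I_n * 'I_n}) :
  {in A, forall t, distinct3 t} -> {in A &, injective set3} ->
  #|signed_family A| = (2 * #|A|)%N.
Proof.
move=> dA iA; rewrite card_in_imset; first by rewrite cardsX cardsT card_bool mulnC.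
move=> [t s] [t' s'] /setXP[tA _] /setXP[t'A _] /= E.
have tt' : t = t' by apply: iA; rewrite // -(supp_svec s) ?E ?supp_svec ?dA.
subst t'; congr (_, _); have := dA t tA; case: t E {tA t'A} => [[a b] c] E d.
have := svecE s c d; rewrite E svecE // /signed_delta !val_eqE /= eqxx.
have /and3P[/= _ ac bc] := d.
by rewrite eq_sym (negPf ac) eq_sym (negPf bc); case: s s' {E} => [] [].
Qed.

Lemma admissible3 (V : {set 'rV[trit]_n}) :
  {in V, forall v, #|supp v| = 3%N} -> {in V &, forall v w, 0 <= scalar_product v w} ->
  admissible 3 0 V.
Proof.
move=> V3 V0; apply/andP; split; apply/forall_inP => v vV; first exact/eqP/V3.
by apply/forall_inP => w wV; apply: V0.
Qed.

Lemma admissible_signed_family (A : {set 'I_n * 'I_n * 'I_n}) :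
  {in A, forall t, distinct3 t} ->
  (forall t t' s s', t \in A -> t' \in A ->
    0 <= scalar_product (svec t s) (svec t' s')) ->
  admissible 3 0 (signed_family A).
Proof.
move=> dA A0; apply: admissible3 => [v|v w].
  by case/signed_familyP=> t [s [tA ->]]; rewrite supp_svec ?card_set3 ?dA.
by move=> /signed_familyP[t [s [tA ->]]] /signed_familyP[t' [s' [tA' ->]]]; apply: A0.
Qed.

Lemma le_F (V : {set 'rV[trit]_n}) : admissible 3 0 V -> (#|V| <= F n 3 0)%N.
Proof.
by move=> adV; rewrite /F (@leq_bigmax_cond _ _ (fun V : {set 'rV[trit]_n} => #|V|)).
Qed.

Lemma F_le m : (forall V : {set 'rV[trit]_n}, admissible 3 0 V -> (#|V| <= m)%N) ->
  (F n 3 0 <= m)%N.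
Proof. by move=> H; apply/bigmax_leqP. Qed.

(** For a concrete n the right side can be evaluated by computation. *)
Lemma card_triples_sum (Q : nat -> nat -> nat -> bool) :
  #|[set t : 'I_n * 'I_n * 'I_n | Q t.1.1 t.1.2 t.2]| =
  (\sum_(0 <= i < n) \sum_(0 <= j < n) \sum_(0 <= k < n) Q i j k)%N.
Proof.
rewrite cardsE -sum1_card big_mkcond /= big_mkord.
rewrite -(pair_bigA _ (fun (p : 'I_n * 'I_n) (k : 'I_n) =>
  if Q p.1 p.2 k then 1%N else 0%N)) /=.
rewrite -(pair_bigA _ (fun i j : 'I_n => \sum_(k < n) if Q i j k then 1%N else 0%N)%N) /=.
apply: eq_bigr => i _; rewrite big_mkord; apply: eq_bigr => j _.
by rewrite big_mkord; apply: eq_bigr => k _; case: (Q i j k).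
Qed.

End SignedTriples.

(** * Lower bounds from explicit families *)

(** For a < b < c, at least two of the points lie in {0, 1, 2} exactly when b does. *)
Definition vfam_triples n : {set 'I_n * 'I_n * 'I_n} :=
  [set t : 'I_n * 'I_n * 'I_n | [&& t.1.1 < t.1.2, t.1.2 < t.2 & t.1.2 < 3]].

Lemma sorted_distinct n (a b c : 'I_n) : a < b -> b < c -> distinct3 (a, b, c).
Proof. by rewrite /distinct3 -!val_eqE /=; lia. Qed.

Lemma Vfam_signed n : Vfam n = signed_family (vfam_triples n).
Proof.
apply/setP=> x; rewrite inE; apply/idP/signed_familyP.
  case/existsP=> a /existsP[b /existsP[c /and3P[/andP[ab bc] ge2 xE]]].
  exists (a, b, c), (x == vvec a b c); split; last first.
    move: xE; rewrite !inE /svec.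
    by case: (x =P vvec a b c) => [->|_] //=; rewrite orbF => /eqP.
  (* If b >= 3, at most a remains in the intersection. *)
  rewrite inE /= ab bc /=; move: ge2; apply: contraTT; rewrite -!leqNgt => b3.
  apply: leq_trans (subset_leq_card _) (eq_leq (cards1 a)).
  apply/subsetP=> i; rewrite !inE -!val_eqE /=; lia.
case=> [[[a b] c] [s []]]; rewrite inE /= => /and3P[ab bc b3] ->.
apply/existsP; exists a; apply/existsP; exists b; apply/existsP; exists c.
rewrite ab bc /=; apply/andP; split; last by rewrite !inE /svec; case: s; rewrite eqxx ?orbT.
have ab2 : #|[set a; b]| = 2 by rewrite cards2 -val_eqE /=; move: ab; case: ltngtP.
rewrite -[X in X <= _]ab2; apply: subset_leq_card; apply/subsetP=> i.
by rewrite !inE -!val_eqE /=; lia.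
Qed.

Lemma set3P n (a b c a' b' c' : 'I_n) : set3 (a, b, c) = set3 (a', b', c') ->
  forall i : 'I_n, [|| i == a :> nat, i == b :> nat | i == c :> nat] =
    [|| i == a' :> nat, i == b' :> nat | i == c' :> nat].
Proof. by move=> /setP E i; have := E i; rewrite !inE -!orbA. Qed.

Lemma vfam_triples_distinct n : {in vfam_triples n, forall t, distinct3 t}.
Proof. by case=> [[a b] c]; rewrite inE => /and3P[ab bc _]; apply: sorted_distinct. Qed.

Lemma vfam_triples_inj n : {in vfam_triples n &, injective (@set3 n)}.
Proof.
move=> [[a b] c] [[a' b'] c']; rewrite !inE /=.
move=> /and3P[ab bc _] /and3P[ab' bc' _] /set3P E.
have := E a; have := E b; have := E c; rewrite !eqxx ?orbT.
move=> /esym/or3P c_in /esym/or3P b_in /esym/or3P a_in.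
have [ea eb ec] : [/\ a = a' :> nat, b = b' :> nat & c = c' :> nat].
  by case: a_in => /eqP; case: b_in => /eqP; case: c_in => /eqP; split; lia.
by congr (_, _, _); apply: val_inj.
Qed.

(** The pairs {a, b} and {a', b'} lie in {0, 1, 2}, so they share a point, which contributes 1. At
    most one coordinate contributes -1: two of them would need c in {a', b'} and c' in {a, b},
    against c > b and c' > b'. The case analysis checks this. *)
Lemma admissible_Vfam n : admissible 3 0%R (Vfam n).
Proof.
rewrite Vfam_signed; apply: admissible_signed_family.
  exact: vfam_triples_distinct.
move=> t t' s s' tA tA'.
have d := vfam_triples_distinct tA; have d' := vfam_triples_distinct tA'.
rewrite scalar_svec2 //=.
case: t t' tA tA' {d d'} => [[a b] c] [[a' b'] c']; rewrite !inE /=.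
move: (a : nat) (b : nat) (c : nat) (a' : nat) (b' : nat) (c' : nat).
move=> {a b c a' b' c'} a b c a' b' c' /and3P[ab bc b3] /and3P[ab' bc' b3'].
move: a b c a' b' c' ab bc b3 ab' bc' b3'.
do 2![case=> [|[|?]] [|[|[|?]]] [|[|[|?]]] //]; move=> *;
  rewrite /signed_delta /= ?eqSS; case: s; case: s' => //; by case: eqP.
Qed.

Lemma card_Vfam n : #|Vfam n| = 2 * (\sum_(0 <= i < n) \sum_(0 <= j < n)
  \sum_(0 <= k < n) [&& i < j, j < k & j < 3]).
Proof.
rewrite Vfam_signed card_signed_family; last exact: vfam_triples_inj.
  by rewrite -(card_triples_sum n (fun i j k => [&& i < j, j < k & j < 3])).
exact: vfam_triples_distinct.
Qed.

Lemma card_Vfam345 : [/\ #|Vfam 3| = 2, #|Vfam 4| = 8 & #|Vfam 5| = 14].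
Proof. by rewrite !card_Vfam !unlock. Qed.

(* The triples (a, 5, b) with a < b < 5, the free point b in last position.
   Once they are all doubled, {0, 1, 2} is the only other possible support. *)
Definition triples6 : {set 'I_6 * 'I_6 * 'I_6} :=
  [set t : 'I_6 * 'I_6 * 'I_6 | [&& t.1.1 < t.2, t.2 < 5 & t.1.2 == 5 :> nat]].

Lemma triples6_distinct : {in triples6, forall t, distinct3 t}.
Proof.
case=> [[a b] c]; rewrite inE /= => /and3P[ac c5 /eqP b5].
by rewrite /distinct3 -!val_eqE /=; lia.
Qed.

Lemma triples6_inj : {in triples6 &, injective (@set3 6)}.
Proof.
move=> [[a b] c] [[a' b'] c']; rewrite !inE /=.
move=> /and3P[ac c5 /eqP b5] /and3P[ac' c5' /eqP b5'] /set3P E.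
have := E a; have := E b; have := E c; rewrite !eqxx ?orbT.
move=> /esym/or3P c_in /esym/or3P b_in /esym/or3P a_in.
have [ea eb ec] : [/\ a = a' :> nat, b = b' :> nat & c = c' :> nat].
  by case: a_in => /eqP; case: b_in => /eqP; case: c_in => /eqP; split; lia.
by congr (_, _, _); apply: val_inj.
Qed.

(** Two vectors from [triples6] gain 1 at point 5 and lose 1 at no more than one other point.
    Against the vector on {0, 1, 2}, a loss at the free point b <= 2 is offset at a < b. *)
Lemma F6_ge : 21 <= F 6 3 0%R.
Proof.
pose o i : 'I_6 := inord i; pose t0 := (o 0, o 1, o 2).
have o1 i : i < 6 -> o i = i :> nat by apply: inordK.
have d0 : distinct3 t0 by apply: sorted_distinct; rewrite !o1.
have t0n : svec t0 false \notin signed_family triples6.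
  apply/negP=> /signed_familyP[[[a b] c] [s [tA E]]].
  (* Every support from [triples6] contains 5, unlike {0, 1, 2}. *)
  have : b \in set3 t0.
    by rewrite -(supp_svec false d0) E supp_svec ?triples6_distinct // !inE eqxx orbT.
  move: tA; rewrite !inE /= => /and3P[_ _ /eqP b5].
  by rewrite -!val_eqE /= b5 !o1.
have c6 : #|triples6| = 10.
  rewrite (card_triples_sum 6 (fun i j k => [&& i < k, k < 5 & j == 5])).
  by rewrite !unlock.
have <- : #|svec t0 false |: signed_family triples6| = 21.
  rewrite cardsU1 t0n card_signed_family ?c6 //; first exact: triples6_distinct.
  exact: triples6_inj.
have dU t s : t \in t0 |: triples6 -> distinct3 t.
  by rewrite in_setU1 => /orP[/eqP->|/triples6_distinct].
pose ok (t : 'I_6 * 'I_6 * 'I_6) s := ((t == t0) && ~~ s) || (t \in triples6).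
have inok x : x \in svec t0 false |: signed_family triples6 ->
    exists t s, [/\ ok t s, distinct3 t & x = svec t s].
  rewrite in_setU1 => /orP[/eqP->|/signed_familyP[t [s [tA ->]]]].
    by exists t0, false; rewrite /ok eqxx.
  by exists t, s; split=> //; [rewrite /ok tA orbT | apply: triples6_distinct].
apply: le_F; apply: admissible3 => [v /inok[t [s [_ d ->]]]|].
  by rewrite supp_svec ?card_set3.
move=> v w /inok[t [s [okt d ->]]] /inok[t' [s' [okt' d' ->]]].
rewrite scalar_svec2 //=.
have okE (a b c : 'I_6) r : ok (a, b, c) r ->
    [&& a == 0 :> nat, b == 1 :> nat, c == 2 :> nat & ~~ r] ||
    [&& a < c, c < 5 & b == 5 :> nat].
  by rewrite /ok inE !xpair_eqE -!val_eqE /= !o1 // -!andbA.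
case: t t' okt okt' {d d'} => [[a b] c] [[a' b'] c'] /okE k /okE k' /=.
move: (a : nat) (b : nat) (c : nat) (a' : nat) (b' : nat) (c' : nat) k k'.
move=> {a b c a' b' c'} a b c a' b' c'.
case/orP=> [/and4P[/eqP-> /eqP-> /eqP-> /negbTE->]|/and3P[ac c5 /eqP->]];
  case/orP=> [/and4P[/eqP-> /eqP-> /eqP-> /negbTE->]|/and3P[ac' c5' /eqP->]] //.
- by case: c' c5' ac' => [|[|[|[|[|?]]]]] // _; case: a' => [|[|[|[|?]]]] // _; case: s'.
- by case: c c5 ac => [|[|[|[|[|?]]]]] // _; case: a => [|[|[|[|?]]]] // _; case: s.
case: c c5 ac => [|[|[|[|[|?]]]]] // _; case: a => [|[|[|[|?]]]] // _;
  case: c' c5' ac' => [|[|[|[|[|?]]]]] // _; case: a' => [|[|[|[|?]]]] // _;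
  by case: s; case: s'.
Qed.

(** The 0/1 vectors with three ones have nonnegative scalar products. *)
Lemma F_ge_binomial n : 'C(n, 3) <= F n 3 0%R.
Proof.
pose ind (B : {set 'I_n}) : 'rV[trit]_n := (\row_i (if i \in B then trit1 else trit0))%R.
have suppI B : supp (ind B) = B.
  by apply/setP=> i; rewrite in_supp mxE; case: (i \in B).
rewrite -{1}(card_ord n) -cardsT -cards_draws -(card_imset _ (can_inj suppI)).
apply/le_F/admissible3 => [v /imsetP[B]|v w /imsetP[B _ ->] /imsetP[B' _ ->]].
  by rewrite inE subsetT => /= /eqP B3 ->; rewrite suppI.
apply: sumr_ge0 => i _; rewrite !mxE.
by case: (i \in B); case: (i \in B').
Qed.

Theorem theorem3 :
  ((forall n : nat, 3 <= n <= 5 -> F n 3 0%R = #|Vfam n|) /\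
   [/\ #|Vfam 3| = 2, #|Vfam 4| = 8 & #|Vfam 5| = 14]) /\
  F 6 3 0%R = 21 /\
  (forall n : nat, 7 <= n -> F n 3 0%R = 'C(n, 3)).
Proof.
have [V3 V4 V5] := card_Vfam345.
split; [split=> // n n35|split=> [|n n7]]; apply/eqP; rewrite eqn_leq; apply/andP; split.
- apply: F_le => V adV; have [] := admissible_card_le _ adV; first by lia.
  (* Twice ['C(n, 3)] is 2 and 8 for n = 3, 4, the sizes of [Vfam]; only n = 5 takes the bound
     14. *)
  move: n35 V adV; case: n => [|[|[|[|[|[|n]]]]]] // _ V _ le2 le5 _ _.
  + by rewrite V3.
  + by rewrite V4.
  + by rewrite V5 le5.
- exact/le_F/admissible_Vfam.
- by apply: F_le => V adV; have [] := admissible_card_le _ adV => // _ _ le6 _; apply: le6.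
- exact: F6_ge.
- apply: F_le => V adV.
  by have [] := admissible_card_le _ adV => [|_ _ _ le7]; [lia | apply: le7].
- exact: F_ge_binomial.
Qed.
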